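(* Let $h$ be a partial function from $[-1,1]$ to $[0,1]$ such that $\mathrm{Dom}(h)$ is dense in $[-1,1]$ and $h$ is non-decreasing, i.e. $\forall x,y\in\mathrm{Dom}(h)[x<y\rightarrow h(x)\le h(y)]$. Then all but countably many elements of $[-1,1]$ are points of continuity for $h$: there exists an infinite sequence $z_0,z_1,\dots$ of reals such that every $u\in[-1,1]$ with $\forall n[u\,\#\,z_n]$ is a point of continuity for $h$.
   Context: Setting: intuitionistic mathematics (intuitionistic logic), with countable choice. Reals: shrinking, dwindling sequences of pairs of rationals, $x<y\iff\exists n[x''(n)<y'(n)]$; apartness $x\,\#\,y$ iff $x<y\vee y<x$. A partial function from $[-1,1]$ to $[0,1]$ is a relation $h\subseteq[-1,1]\times[0,1]$ that is functional and respects real equality; $\mathrm{Dom}(h)$ is its domain. $\mathrm{Dom}(h)$ is dense in $[-1,1]$ if every open interval $(a,b)$ with $-1\le a<b\le1$ contains an element of $\mathrm{Dom}(h)$. A real $u\in[-1,1]$ is a point of continuity for $h$ iff $\forall n\,\exists t\in\mathrm{Dom}(h)\,\exists w\in\mathrm{Dom}(h)[t<u<w\wedge h(w)-h(t)<2^{-n}]$. *)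

(* Defs.v *)
From Stdlib Require Import Arith QArith Qpower Lqa Lia.

Definition two_pow_neg (n : nat) : Q := (2 ^ (- Z.of_nat n))%Q.

Record real : Type := Real {
  real_seq : nat -> Q * Q;
  real_shrinking : forall n,
    (fst (real_seq n) <= fst (real_seq (S n)))%Q /\
    (fst (real_seq (S n)) <= snd (real_seq (S n)))%Q /\
    (snd (real_seq (S n)) <= snd (real_seq n))%Q;
  real_dwindling : forall m, exists n,
    (snd (real_seq n) - fst (real_seq n) < two_pow_neg m)%Q
}.

(* [lower x n] and [upper x n] are the rationals x'(n) and x''(n). *)
Definition lower (x : real) (n : nat) : Q := fst (real_seq x n).
Definition upper (x : real) (n : nat) : Q := snd (real_seq x n).

Declare Scope real_scope.
Delimit Scope real_scope with real.
Bind Scope real_scope with real.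

Definition rlt (x y : real) : Prop := exists n, (upper x n < lower y n)%Q.
Definition rle (x y : real) : Prop := forall n, (lower x n <= upper y n)%Q.
Definition req (x y : real) : Prop := rle x y /\ rle y x.
Definition rapart (x y : real) : Prop := rlt x y \/ rlt y x.

Lemma two_pow_neg_pos (n : nat) : (0 < two_pow_neg n)%Q.
Proof. apply Qpower_0_lt; reflexivity. Qed.

Lemma two_pow_neg_half (n : nat) :
  (two_pow_neg (S n) + two_pow_neg (S n) == two_pow_neg n)%Q.
Proof.
unfold two_pow_neg.
replace (- Z.of_nat n)%Z with (- Z.of_nat (S n) + 1)%Z by lia.
rewrite Qpower_plus by discriminate.
change (2 ^ 1)%Q with 2%Q; ring.
Qed.

Lemma lower_mono (x : real) (m n : nat) :
  (m <= n)%nat -> (lower x m <= lower x n)%Q.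
Proof.
induction 1 as [|n _ IH]; [apply Qle_refl|].
apply Qle_trans with (1 := IH), (real_shrinking x n).
Qed.

Lemma upper_mono (x : real) (m n : nat) :
  (m <= n)%nat -> (upper x n <= upper x m)%Q.
Proof.
induction 1 as [|n _ IH]; [apply Qle_refl|].
apply Qle_trans with (2 := IH), (real_shrinking x n).
Qed.

Definition real_of_Q (q : Q) : real.
Proof.
refine (Real (fun _ => (q, q)) _ _).
- intros n; cbn; repeat split; apply Qle_refl.
- intros m; exists O; cbn.
  pose proof (two_pow_neg_pos m); lra.
Defined.

Definition rsub (x y : real) : real.
Proof.
refine (Real (fun n => (lower x n - upper y n, upper x n - lower y n)%Q) _ _).
- intros n; cbn.
  pose proof (real_shrinking x n); pose proof (real_shrinking y n).
  unfold lower, upper; repeat split; lra.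
- intros m; cbn.
  destruct (real_dwindling x (S m)) as [i Hi].
  destruct (real_dwindling y (S m)) as [j Hj].
  fold (lower x i) (upper x i) in Hi; fold (lower y j) (upper y j) in Hj.
  pose proof (two_pow_neg_half m).
  exists (Nat.max i j).
  pose proof (lower_mono x i (Nat.max i j) (Nat.le_max_l i j)).
  pose proof (upper_mono x i (Nat.max i j) (Nat.le_max_l i j)).
  pose proof (lower_mono y j (Nat.max i j) (Nat.le_max_r i j)).
  pose proof (upper_mono y j (Nat.max i j) (Nat.le_max_r i j)).
  lra.
Defined.

Notation "x < y" := (rlt x y) : real_scope.
Notation "x <= y" := (rle x y) : real_scope.
Notation "x == y" := (req x y) : real_scope.
Notation "x - y" := (rsub x y) : real_scope.
Notation "x # y" := (rapart x y) : real_scope.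
Notation "0" := (real_of_Q 0) : real_scope.
Notation "1" := (real_of_Q 1) : real_scope.
Notation "-1" := (real_of_Q (-1)) : real_scope.
Notation "x <= y <= z" := (rle x y /\ rle y z) : real_scope.
Notation "x < y < z" := (rlt x y /\ rlt y z) : real_scope.

Local Open Scope real_scope.

(* Real equality is [==], so functionality and compatibility with real equality
   are a single condition. The relation itself is not required to be closed
   under [==]: this only makes the class of partial functions larger. *)
Definition partial_function (h : real -> real -> Prop) : Prop :=
  (forall x y, h x y -> -1 <= x <= 1 /\ 0 <= y <= 1) /\
  (forall x x' y y', h x y -> h x' y' -> x == x' -> y == y').

Definition Dom (h : real -> real -> Prop) (x : real) : Prop :=
  exists y, h x y.

Definition dense_domain (h : real -> real -> Prop) : Prop :=
  forall a b, -1 <= a -> a < b -> b <= 1 -> exists t, Dom h t /\ a < t < b.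

Definition nondecreasing (h : real -> real -> Prop) : Prop :=
  forall x y hx hy, h x hx -> h y hy -> x < y -> hx <= hy.

(* [ht] and [hw] are the values of [h] at [t] and [w]. *)
Definition continuity_point (h : real -> real -> Prop) (u : real) : Prop :=
  forall n, exists t ht w hw,
    h t ht /\ h w hw /\ t < u < w /\ hw - ht < real_of_Q (two_pow_neg n).

(* Main.v *)
(** Fix [k] and put [d = 2^-k]. For each [i], trisection yields a real [zeta k i] at
    which [h] crosses the band [[i d, (i+1) d]]: [h <= (i+1) d] to its left and
    [h >= i d] to its right. A trisection step needs only one point of [Dom h] in the
    middle third, since the value there is either [< (i+1) d] or [> i d]. If [u] is apart
    from [-1], [1] and every [zeta k i], scan [zeta k 1], [zeta k 2], ... up
    to the first [zeta k (i+1)] with [u < zeta k (i+1)], or as far as [i d = 1]: to the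
    left of [u] there is a point with value at least [i d], to the right one with value
    at most [(i+2) d]. Excluded middle is not used, only choice. *)

Require Import Defs.
From Stdlib Require Import QArith.
From Stdlib Require Import Arith ZArith Lqa Lia Qpower IndefiniteDescription Cantor.
Local Open Scope real_scope.

(** * Order of the reals and comparison with rationals *)

Lemma lower_le_upper (x : real) (m n : nat) : (lower x m <= upper x n)%Q.
Proof.
pose proof (lower_mono x m (S (Nat.max m n)) ltac:(lia)).
pose proof (upper_mono x n (S (Nat.max m n)) ltac:(lia)).
destruct (real_shrinking x (Nat.max m n)) as (_ & Hle & _).
unfold lower, upper in *; lra.
Qed.

Lemma rle_lower_upper (x y : real) (m n : nat) :
  x <= y -> (lower x m <= upper y n)%Q.
Proof.
intros H; specialize (H (Nat.max m n)).
pose proof (lower_mono x m (Nat.max m n) (Nat.le_max_l m n)).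
pose proof (upper_mono y n (Nat.max m n) (Nat.le_max_r m n)).
lra.
Qed.

Lemma rlt_of_upper_lower (x y : real) (m n : nat) :
  (upper x m < lower y n)%Q -> x < y.
Proof.
intros H; exists (Nat.max m n).
pose proof (upper_mono x m (Nat.max m n) (Nat.le_max_l m n)).
pose proof (lower_mono y n (Nat.max m n) (Nat.le_max_r m n)).
lra.
Qed.

Lemma rlt_trans (x y z : real) : x < y -> y < z -> x < z.
Proof.
intros [m Hm] [n Hn]; apply rlt_of_upper_lower with m n.
pose proof (lower_le_upper y m n); lra.
Qed.

Lemma rlt_not_rle (x y : real) : x < y -> ~ y <= x.
Proof.
intros [n Hn] H; specialize (H n); lra.
Qed.

Lemma rle_rlt_rle (x y z : real) : x <= y -> y < z -> x <= z.
Proof.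
intros H [n Hn] m.
pose proof (rle_lower_upper x y m n H); pose proof (lower_le_upper z n m); lra.
Qed.

Lemma rlt_rle_rle (x y z : real) : x < y -> y <= z -> x <= z.
Proof.
intros [n Hn] H m.
pose proof (rle_lower_upper y z n m H); pose proof (lower_le_upper x m n); lra.
Qed.

Lemma rle_real_of_Q (p q : Q) : (p <= q)%Q -> real_of_Q p <= real_of_Q q.
Proof. intros H n; exact H. Qed.

Lemma rlt_real_of_Q (p q : Q) : (p < q)%Q -> real_of_Q p < real_of_Q q.
Proof. intros H; exists O; exact H. Qed.

(** An approximation of [y] shorter than the gap between [a] and [b] cannot reach both, so comparing
    its upper end with [b], a decidable matter of rationals, settles the disjunction. *)
Lemma rlt_cotrans_Q (y : real) (a b : Q) (k : nat) :
  (a + two_pow_neg k <= b)%Q -> y < real_of_Q b \/ real_of_Q a < y.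
Proof.
intros Hab; destruct (real_dwindling y k) as [n Hn].
destruct (Qlt_le_dec (upper y n) b) as [H|H].
- left; exists n; exact H.
- right; exists n; unfold lower, upper in *; cbn; lra.
Qed.

(** The term [two_pow_neg k] buys strictness: approximations of [x] and [y] of width below half of
    it suffice. *)
Lemma rsub_lt (x y : real) (a b : Q) (k : nat) :
  x <= real_of_Q b -> real_of_Q a <= y ->
  x - y < real_of_Q (b - a + two_pow_neg k).
Proof.
intros Hx Hy.
destruct (real_dwindling x (S k)) as [m Hm].
destruct (real_dwindling y (S k)) as [n Hn].
pose proof (two_pow_neg_half k).
exists (Nat.max m n); cbn.
pose proof (upper_mono x m (Nat.max m n) (Nat.le_max_l m n)).
pose proof (lower_mono y n (Nat.max m n) (Nat.le_max_r m n)).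
specialize (Hx m); specialize (Hy n).
unfold lower, upper in *; cbn in *; lra.
Qed.

Lemma two_pow_neg_mul_pow (k : nat) :
  (inject_Z (2 ^ Z.of_nat k) * two_pow_neg k == 1)%Q.
Proof.
rewrite Zpower_Qpower by lia.
unfold two_pow_neg; rewrite <- Qpower_plus by discriminate.
rewrite Z.add_opp_diag_r; reflexivity.
Qed.

(** * Locating a crossing by trisection *)

Section Trisection.

Variables (h : real -> real -> Prop) (a b : Q).
Hypotheses (hdense : dense_domain h) (hmono : nondecreasing h).

Definition brackets (I : Q * Q) : Prop :=
  (-(1) <= fst I /\ fst I < snd I /\ snd I <= 1)%Q /\
  (forall t y, h t y -> t < real_of_Q (fst I) -> y <= real_of_Q b) /\
  (forall t y, h t y -> real_of_Q (snd I) < t -> real_of_Q a <= y).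

Definition refines (c : Q) (I J : Q * Q) : Prop :=
  (fst I <= fst J /\ snd J <= snd I /\ snd J - fst J <= c * (snd I - fst I))%Q.

Lemma brackets_two_thirds (k : nat) (I : Q * Q) :
  (a + two_pow_neg k <= b)%Q -> brackets I ->
  exists J, brackets J /\ refines (2 # 3) I J.
Proof.
intros Hab; destruct I as [p q]; intros ((Hp & Hpq & Hq) & HL & HU); cbn in *.
set (p' := (p + (1 # 3) * (q - p))%Q).
set (q' := (q - (1 # 3) * (q - p))%Q).
destruct (hdense (real_of_Q p') (real_of_Q q')) as (t & [y Hy] & Hpt & Htq).
{ apply rle_real_of_Q; unfold p'; lra. }
{ apply rlt_real_of_Q; unfold p', q'; lra. }
{ apply rle_real_of_Q; unfold q'; lra. }
destruct (rlt_cotrans_Q y a b k Hab) as [Hyb|Hya].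
- exists (p', q); split; [split; [|split]|]; cbn.
  + unfold p'; lra.
  + intros s x Hs Hsp; apply rle_rlt_rle with y; [|exact Hyb].
    apply (hmono s t x y Hs Hy), rlt_trans with (1 := Hsp), Hpt.
  + exact HU.
  + unfold refines, p'; cbn; lra.
- exists (p, q'); split; [split; [|split]|]; cbn.
  + unfold q'; lra.
  + exact HL.
  + intros s x Hs Hqs; apply rlt_rle_rle with y; [exact Hya|].
    apply (hmono t s y x Hy Hs), rlt_trans with (2 := Hqs), Htq.
  + unfold refines, q'; cbn; lra.
Qed.

(** Two trisection steps shrink by 4/9, below 1/2, so widths compare directly with powers of two. *)
Lemma brackets_half (k : nat) (I : Q * Q) :
  (a + two_pow_neg k <= b)%Q -> brackets I ->
  exists J, brackets J /\ refines (1 # 2) I J.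
Proof.
intros Hab HI.
destruct (brackets_two_thirds k I Hab HI) as (J & HJ & HIJ).
destruct (brackets_two_thirds k J Hab HJ) as (K & HK & HJK).
exists K; split; [exact HK|].
destruct HI as [HI _]; unfold refines in *; lra.
Qed.

Lemma exists_crossing (k : nat) :
  (a + two_pow_neg k <= b)%Q ->
  (forall t y, h t y -> -1 <= t <= 1) ->
  exists z, -1 <= z <= 1 /\
    (forall t y, h t y -> t < z -> y <= real_of_Q b) /\
    (forall t y, h t y -> z < t -> real_of_Q a <= y).
Proof.
intros Hab Hdom.
(* Both outer conditions are vacuous here, as no point of the domain lies outside [-1,1]. *)
assert (H0 : brackets (-(1), 1)%Q).
{ split; [cbn; lra|split; cbn; intros t y Ht Hlt];
  destruct (rlt_not_rle _ _ Hlt); apply (Hdom t y Ht). }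
(* Choosing on the subset type keeps the invariant attached to the interval, so the step function
   can be iterated. *)
destruct (functional_choice
  (fun I J : {I | brackets I} => refines (1 # 2) (proj1_sig I) (proj1_sig J)))
  as [next Hnext].
{ intros [I HI]; destruct (brackets_half k I Hab HI) as (J & HJ & HIJ).
  exists (exist _ J HJ); exact HIJ. }
set (s := fun n => Nat.iter n next (exist _ _ H0)).
assert (Hs : forall n, refines (1 # 2) (proj1_sig (s n)) (proj1_sig (s (S n)))).
{ intros n; apply Hnext. }
assert (Hw : forall n,
  (snd (proj1_sig (s n)) - fst (proj1_sig (s n)) <= 2 * two_pow_neg n)%Q).
{ induction n as [|n IH]; [cbn; discriminate|].
  pose proof (two_pow_neg_half n); destruct (Hs n) as (_ & _ & Hn); lra. }
unshelve eset (z := Real (fun n => proj1_sig (s n)) _ _).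
{ intros n; pose proof (proj1 (proj2_sig (s (S n)))); pose proof (Hs n).
  unfold refines in *; lra. }
(* The initial width is 2, hence the shift by two: one for this factor, one for strictness. *)
{ intros m; exists (S (S m)); cbv beta.
  pose proof (two_pow_neg_half m); pose proof (two_pow_neg_half (S m)).
  pose proof (two_pow_neg_pos m); specialize (Hw (S (S m))); lra. }
exists z; split; [split|split].
- intros n; pose proof (proj1 (proj2_sig (s n))); unfold lower, upper; cbn; lra.
- intros n; pose proof (proj1 (proj2_sig (s n))); unfold lower, upper; cbn; lra.
(* A witness [n] of [t < z] already places [t] left of the [n]-th interval. *)
- intros t y Ht [n Hn]; apply (proj1 (proj2 (proj2_sig (s n))) t y Ht).
  exists n; exact Hn.
- intros t y Ht [n Hn]; apply (proj2 (proj2 (proj2_sig (s n))) t y Ht).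
  exists n; exact Hn.
Qed.

End Trisection.

(** * Bands of values and the scan through their crossings *)

Definition level (k i : nat) : Q := (inject_Z (Z.of_nat i) * two_pow_neg k)%Q.

Lemma level_S (k i : nat) : (level k (S i) == level k i + two_pow_neg k)%Q.
Proof.
unfold level; rewrite Nat2Z.inj_succ; unfold Z.succ; rewrite inject_Z_plus; ring.
Qed.

Lemma exists_crossing_family (h : real -> real -> Prop) :
  partial_function h -> dense_domain h -> nondecreasing h ->
  exists zeta : nat * nat -> real, forall k i,
    -1 <= zeta (k, i) <= 1 /\
    (forall t y, h t y -> t < zeta (k, i) -> y <= real_of_Q (level k (S i))) /\
    (forall t y, h t y -> zeta (k, i) < t -> real_of_Q (level k i) <= y).
Proof.
intros hfun hdense hmono.
destruct (functional_choice (fun (ki : nat * nat) z => -1 <= z <= 1 /\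
  (forall t y, h t y -> t < z -> y <= real_of_Q (level (fst ki) (S (snd ki)))) /\
  (forall t y, h t y -> z < t -> real_of_Q (level (fst ki) (snd ki)) <= y)))
  as [zeta Hzeta].
{ intros [k i]; apply (exists_crossing h _ _ hdense hmono k); cbn.
  - rewrite level_S; apply Qle_refl.
  - intros t y Ht; apply (proj1 hfun t y Ht). }
exists zeta; intros k i; apply (Hzeta (k, i)).
Qed.

Lemma small_oscillation (h : real -> real -> Prop) (k : nat) (zeta : nat -> real)
    (u : real) :
  partial_function h -> dense_domain h ->
  (forall i, -1 <= zeta i <= 1 /\
    (forall t y, h t y -> t < zeta i -> y <= real_of_Q (level k (S i))) /\
    (forall t y, h t y -> zeta i < t -> real_of_Q (level k i) <= y)) ->
  -1 < u -> u < 1 -> -1 <= u <= 1 -> (forall i, u # zeta i) ->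
  exists i t ht w hw, h t ht /\ h w hw /\ t < u < w /\
    real_of_Q (level k i) <= ht /\ hw <= real_of_Q (level k (S (S i))).
Proof.
intros [hrange _] hdense Hzeta Hu0 Hu1 [Hu0' Hu1'] Hap.
set (goal := exists i, _).
assert (Hscan : forall j, goal \/
  exists t ht, h t ht /\ t < u /\ real_of_Q (level k j) <= ht).
{ induction j as [|j IH].
  - destruct (hdense -1 u) as (t & [ht Ht] & _ & Htu); auto; [intro; discriminate|].
    right; exists t, ht; repeat split; auto.
    intros n; pose proof (proj1 (proj2 (hrange t ht Ht)) n) as H; cbn in H.
    apply Qle_trans with (2 := H); cbn.
    unfold level; rewrite Qmult_0_l; apply Qle_refl.
  - destruct IH as [IH|(t & ht & Ht & Htu & Hl)]; [left; exact IH|].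
    destruct (Hzeta (S j)) as ((Hz0 & Hz1) & HL & HU).
    (* If [u] is left of the crossing, a point in between has value at most level [j + 2], two bands
       above the point already found; otherwise a point in between carries the scan on. *)
    destruct (Hap (S j)) as [Hlt|Hlt].
    + destruct (hdense u (zeta (S j))) as (w & [hw Hw] & Huw & Hwz); auto.
      left; exists j, t, ht, w, hw; repeat split; auto.
      apply (HL w hw Hw Hwz).
    + destruct (hdense (zeta (S j)) u) as (s & [hs Hs] & Hzs & Hsu); auto.
      right; exists s, hs; repeat split; auto.
      apply (HU s hs Hs Hzs). }
(* At index 2^k the level is 1, so any point right of [u] serves as [w]. *)
destruct (Hscan (Z.to_nat (2 ^ Z.of_nat k))) as [H|(t & ht & Ht & Htu & Hl)];
  [exact H|].
destruct (hdense u 1) as (w & [hw Hw] & Huw & _); auto; [intro; discriminate|].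
exists (Z.to_nat (2 ^ Z.of_nat k)), t, ht, w, hw; repeat split; auto.
intros n; cbn.
pose proof (proj2 (proj2 (hrange w hw Hw)) n) as H1; cbn in H1.
apply Qle_trans with (1 := H1).
rewrite !level_S; unfold level.
rewrite Z2Nat.id by (apply Z.pow_nonneg; lia).
rewrite two_pow_neg_mul_pow.
pose proof (two_pow_neg_pos k); lra.
Qed.

Theorem theorem5p23 (h : real -> real -> Prop)
    (hfun : partial_function h)
    (hdense : dense_domain h)
    (hmono : nondecreasing h) :
  exists z : nat -> real,
    forall u : real, -1 <= u <= 1 -> (forall n, u # (z n)) ->
      continuity_point h u.
Proof.
destruct (exists_crossing_family h hfun hdense hmono) as [zeta Hzeta].
(* The first two terms force [u] strictly inside the interval; the others enumerate all pairs
   [(k, i)]. *)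
exists (fun n => match n with
  | O => -1 | S O => 1 | S (S m) => zeta (Cantor.of_nat m) end).
intros u [Hu0 Hu1] Hap n.
assert (Hgt : -1 < u).
{ destruct (Hap 0%nat) as [H|H]; [destruct (rlt_not_rle _ _ H Hu0)|exact H]. }
assert (Hlt : u < 1).
{ destruct (Hap 1%nat) as [H|H]; [exact H|destruct (rlt_not_rle _ _ H Hu1)]. }
(* Two bands plus the slack of [rsub_lt] make 3 * 2^-k, which is below 2^-n for [k = n + 2]. *)
set (k := S (S n)).
destruct (small_oscillation h k (fun i => zeta (k, i)) u hfun hdense)
  as (i & t & ht & w & hw & Ht & Hw & Htuw & Hlow & Hup); auto.
{ intros i; pose proof (Hap (S (S (Cantor.to_nat (k, i))))) as H; cbv beta iota in H.
  rewrite Cantor.cancel_of_to in H; exact H. }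
exists t, ht, w, hw; repeat split; try tauto.
destruct (rsub_lt hw ht _ _ k Hup Hlow) as [m Hm]; exists m.
apply Qlt_le_trans with (1 := Hm).
change (level k (S (S i)) - level k i + two_pow_neg k <= two_pow_neg n)%Q.
rewrite !level_S.
pose proof (two_pow_neg_half n); pose proof (two_pow_neg_half (S n)).
pose proof (two_pow_neg_pos k); unfold k in *; lra.
Qed.
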